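(* Let $\Omega\subset\mathbb M_d$ be a bounded matrix convex set. Let $\mathfrak V\subset\Omega$ be an nc relatively bifull subset such that for every $n\in\mathbb N$, $\mathfrak V(n)$ is a smooth analytic subvariety of $\Omega(n)$. Then $\mathfrak V$ is the fixed point set of an nc map $f\colon\Omega\to\Omega$ if and only if $\mathfrak V$ is the image of an nc holomorphic retraction, i.e., there exists an nc map $\psi\colon\Omega\to\Omega$ such that $\psi\circ\psi=\psi$ and $\psi(\Omega)=\mathfrak V$.
   Context: $\mathbb M_d=\bigsqcup_{n\ge1}M_n(\mathbb C)^d$; for $\Omega\subset\mathbb M_d$, $\Omega(n)=\Omega\cap M_n(\mathbb C)^d$. Operations on tuples are coordinatewise. A set is an nc set if it is closed under direct sums $X\oplus Y$. An nc set $\Omega$ is matrix convex if $V^*XV\in\Omega(m)$ for every $X\in\Omega(n)$ and every isometry $V\colon\mathbb C^m\to\mathbb C^n$. Here $\Omega$ is understood to be level-wise open (each $\Omega(n)$ is open). Bounded means that the norms of the elements of $\Omega$ are bounded over all levels (for a matrix convex subset of $\mathbb M_d$ this is the same as each level being bounded). An nc map $f\colon\Omega\to\Omega$ satisfies $f(\Omega(n))\subset\Omega(n)$ for all $n$, $f(X\oplus Y)=f(X)\oplus f(Y)$, and $f(S^{-1}XS)=S^{-1}f(X)S$ whenever $X,S^{-1}XS\in\Omega(n)$, $S\in GL_n(\mathbb C)$. (Being locally bounded, such maps are holomorphic on each level.) The fixed point set of $f$ is $\{X\in\Omega:f(X)=X\}$. A subset $\Xi\subset\Omega$ that is an nc set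 is (relatively) bifull if it is closed under similarities, meaning that for $X\in\Xi(n)$ and $S\in GL_n(\mathbb C)$ with $S^{-1}XS\in\Omega$ we have $S^{-1}XS\in\Xi$, and it is closed under restrictions of its tuples to joint invariant subspaces and under compressions to joint coinvariant subspaces.
   Formalization: The formal theorem also assumes that the nc subset V is nonempty at some level; for empty V the claim fails, e.g. V empty is the fixed point set of X ↦ (X+a)(1+aX)^{-1}, 0<a<1, on the nc unit disc but is not the image of any retraction. *)

(* Defs.v *)
From HB Require Import structures.
From mathcomp Require Import all_boot all_order all_algebra.
From mathcomp Require Import all_classical all_reals all_analysis.
From mathcomp Require Import complex.

Set Implicit Arguments.
Unset Strict Implicit.
Unset Printing Implicit Defensive.

Import Order.TTheory GRing.Theory Num.Theory numFieldNormedType.Exports.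

Local Open Scope classical_set_scope.
Local Open Scope ring_scope.
Local Open Scope sesquilinear_scope.

(* R[i] as a normed space over itself, as the library does for its own number
   fields. *)
HB.instance Definition _ (R : rcfType) := GRing.ComAlgebra.copy R[i] R[i]^o.
HB.instance Definition _ (R : rcfType) := Vector.copy R[i] R[i]^o.
HB.instance Definition _ (R : rcfType) := NormedModule.copy R[i] R[i]^o.

(* The complex field is R[i] for R : realType.  Tuples carry the topology of
   (M_n(C))^d, i.e. the product of the normed topologies of the factors. *)
Definition mtuple (R : realType) (d n : nat) : Type :=
  {ptws 'I_d -> 'M[R[i]]_n}.

(* Graded subsets and graded maps of M_d.  Levels start at n = 1: the component
   of index n lives at matrix size n.+1. *)
Definition nc_family (R : realType) (d : nat) : Type :=
  forall n : nat, set (mtuple R d n.+1).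
Definition nc_function (R : realType) (d : nat) : Type :=
  forall n : nat, mtuple R d n.+1 -> mtuple R d n.+1.

Section Operations.
Variables (R : realType) (d : nat).

(* n.+1 + m.+1 is convertible to (n + m.+1).+1, so the direct sum of levels
   n and m is at level n + m.+1. *)
Definition tuple_dsum (n m : nat) (X : mtuple R d n.+1) (Y : mtuple R d m.+1) :
    mtuple R d (n + m.+1).+1 :=
  fun i => block_mx (X i) 0 0 (Y i).

Definition tuple_sim (n : nat) (S : 'M[R[i]]_n) (X : mtuple R d n) :
    mtuple R d n :=
  fun i => invmx S *m X i *m S.

Definition isometry_mx (n m : nat) (V : 'M[R[i]]_(n, m)) : Prop :=
  V^t* *m V = 1%:M.

Definition tuple_compr (n m : nat) (V : 'M[R[i]]_(n, m)) (X : mtuple R d n) :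
    mtuple R d m :=
  fun i => V^t* *m X i *m V.

(* The range of V is invariant under every X i. *)
Definition joint_invariant (n m : nat) (V : 'M[R[i]]_(n, m))
    (X : mtuple R d n) : Prop :=
  forall i, exists A : 'M[R[i]]_m, X i *m V = V *m A.

(* The orthogonal complement of the range of V is invariant under every X i,
   i.e. the range of V is invariant under every adjoint. *)
Definition joint_coinvariant (n m : nat) (V : 'M[R[i]]_(n, m))
    (X : mtuple R d n) : Prop :=
  forall i, exists A : 'M[R[i]]_m, (X i)^t* *m V = V *m A.

End Operations.

Definition l2norm (R : realType) (n : nat) (v : 'cV[R[i]]_n) : R :=
  Num.sqrt (\sum_(i < n) (ComplexField.Normc.normc (v i 0)) ^+ 2).

(* Not the library norm of matrices, which is the maximum of the entries and
   is not comparable to the operator norm uniformly in n. *)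
Definition opnorm (R : realType) (n : nat) (A : 'M[R[i]]_n) : R :=
  sup [set l2norm (A *m v) | v in [set v : 'cV[R[i]]_n | l2norm v <= 1]].

Section NCSets.
Variables (R : realType) (d : nat).
Implicit Types Omega Xi : nc_family R d.

Definition nc_set Omega : Prop :=
  forall (n m : nat) (X : mtuple R d n.+1) (Y : mtuple R d m.+1),
    Omega n X -> Omega m Y -> Omega (n + m.+1)%N (tuple_dsum X Y).

Definition matrix_convex Omega : Prop :=
  nc_set Omega /\
  forall (n m : nat) (V : 'M[R[i]]_(n.+1, m.+1)) (X : mtuple R d n.+1),
    isometry_mx V -> Omega n X -> Omega m (tuple_compr V X).

Definition nc_open Omega : Prop := forall n : nat, open (Omega n).

Definition nc_bounded Omega : Prop :=
  exists M : R, forall (n : nat) (X : mtuple R d n.+1) (i : 'I_d),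
    Omega n X -> opnorm (X i) <= M.

(* Only the values of f on Omega matter. *)
Definition nc_map Omega (f : nc_function R d) : Prop :=
  [/\ forall (n : nat) (X : mtuple R d n.+1), Omega n X -> Omega n (f n X),
      forall (n m : nat) (X : mtuple R d n.+1) (Y : mtuple R d m.+1),
        Omega n X -> Omega m Y ->
        f (n + m.+1)%N (tuple_dsum X Y) = tuple_dsum (f n X) (f m Y)
    & forall (n : nat) (S : 'M[R[i]]_n.+1) (X : mtuple R d n.+1),
        S \in unitmx -> Omega n X -> Omega n (tuple_sim S X) ->
        f n (tuple_sim S X) = tuple_sim S (f n X)].

(* A subspace of dimension m.+1 is given by an orthonormal basis, i.e. as the
   range of an isometry V; with respect to that basis both the restriction to an
   invariant subspace and the compression to a coinvariant one are V^* X V. *)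
Definition relatively_bifull Omega Xi : Prop :=
  [/\ forall (n : nat) (S : 'M[R[i]]_n.+1) (X : mtuple R d n.+1),
        S \in unitmx -> Xi n X -> Omega n (tuple_sim S X) ->
        Xi n (tuple_sim S X),
      forall (n m : nat) (V : 'M[R[i]]_(n.+1, m.+1)) (X : mtuple R d n.+1),
        isometry_mx V -> Xi n X -> joint_invariant V X ->
        Xi m (tuple_compr V X)
    & forall (n m : nat) (V : 'M[R[i]]_(n.+1, m.+1)) (X : mtuple R d n.+1),
        isometry_mx V -> Xi n X -> joint_coinvariant V X ->
        Xi m (tuple_compr V X)].

Definition fixed_points Omega (f : nc_function R d) : nc_family R d :=
  fun n => [set X | Omega n X /\ f n X = X].

Definition nc_retraction Omega (psi : nc_function R d) : Prop :=
  nc_map Omega psi /\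
  forall (n : nat) (X : mtuple R d n.+1),
    Omega n X -> psi n (psi n X) = psi n X.

End NCSets.

Arguments fixed_points {R d} Omega f n _.

Section AnalyticSets.
Variables (R : realType) (d n : nat).
Implicit Types (U W V : set (mtuple R d n)) (X : mtuple R d n).

(* Coordinates on M_n(C)^d: the i-th row lists the entries of X i.  They make the
   library's Frechet differentiability over R[i] available on tuples. *)
Definition mx_of_mtuple X : 'M[R[i]]_(d, n * n) := \matrix_(i < d) mxvec (X i).
Definition mtuple_of_mx (A : 'M[R[i]]_(d, n * n)) : mtuple R d n :=
  fun i => vec_mx (row i A).

(* Complex differentiability at every point of U, used below for open U. *)
Definition holomorphic_on U (k : nat) (g : mtuple R d n -> 'rV[R[i]]_k) : Prop :=
  forall X, U X -> differentiable (g \o mtuple_of_mx) (mx_of_mtuple X).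

Definition submersive_at (k : nat) (g : mtuple R d n -> 'rV[R[i]]_k) X : Prop :=
  forall w : 'rV[R[i]]_k,
    exists H : 'M[R[i]]_(d, n * n),
      'd (g \o mtuple_of_mx) (mx_of_mtuple X) H = w.

(* On U, V is the common zero set of the k components of the holomorphic g. *)
Definition defining_on U V (k : nat) (g : mtuple R d n -> 'rV[R[i]]_k) : Prop :=
  holomorphic_on U g /\ V `&` U = [set X | U X /\ g X = 0].

(* Asking for local equations at every point of W, not only of V, makes V
   closed in W. *)
Definition analytic_subvariety W V : Prop :=
  V `<=` W /\
  forall X, W X ->
    exists (U : set (mtuple R d n)) (k : nat) (g : mtuple R d n -> 'rV[R[i]]_k),
      [/\ open U, U X, U `<=` W & defining_on U V g].

(* Near X, V is a complex submanifold. *)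
Definition regular_point W V X : Prop :=
  exists (U : set (mtuple R d n)) (k : nat) (g : mtuple R d n -> 'rV[R[i]]_k),
    [/\ open U, U X, U `<=` W, defining_on U V g & submersive_at g X].

Definition smooth_analytic_subvariety W V : Prop :=
  analytic_subvariety W V /\ forall X, V X -> regular_point W V X.

End AnalyticSets.

(* Main.v *)
(* Given f with a fixed point, relax it to F_t(Z) = (1 - t) f(Z) + t X and
   let psi(X) be an ultralimit of Z_p = F_t^((p+1)^2)(X) with t = 1/(p+1).
   Everything rests on the shear [[X, XL - LY], [0, Y]], which is similar to
   X (+) Y, so that f maps the shear of (X, Y) to the shear of (f X, f Y).
   - The largest c with [[Y, c(Y - Z)], [0, Z]] in Omega is a hyperbolic closeness
     of Y and Z which f does not decrease and F_t multiplies by at least 1 + const t,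
     as in the Earle-Hamilton theorem; hence Z_p - f(Z_p) tends to 0.
   - If f(P) = P, then [[P, c(PL - LZ_p)], [0, Z_p]] stays in Omega for one c > 0.
     Compressing it gives a point of Omega beyond Z_p on the ray issued from the
     interior point L^* P L, uniformly in p, so the limit of Z_p is in Omega.
   Hence psi maps Omega to the fixed points of f, and psi(X) = X if f(X) = X. *)

Require Import Defs.
From mathcomp Require Import all_boot all_order all_algebra.
From mathcomp Require Import all_classical all_reals all_analysis.
From mathcomp Require Import complex.
From mathcomp Require Import ring lra.

Set Implicit Arguments.
Unset Strict Implicit.
Unset Printing Implicit Defensive.

Import Order.TTheory GRing.Theory Num.Theory numFieldNormedType.Exports.
Import ComplexField.Normc.

Local Open Scope classical_set_scope.
Local Open Scope ring_scope.
Local Open Scope sesquilinear_scope.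

(** * The real-valued modulus of complex numbers *)

Section ComplexModulus.
Variable R : realType.
Implicit Types x y z : R[i].

Lemma normc_real (a : R) : normc (a%:C)%C = `|a|.
Proof. by rewrite /normc /= expr0n addr0 sqrtr_sqr. Qed.

Lemma normr_normc z : `|z| = (normc z)%:C%C.
Proof. by case: z. Qed.

Lemma normc_ge0 z : 0 <= normc z.
Proof. by case: z => a b; exact: sqrtr_ge0. Qed.

Lemma normc_leD x y : normc (x + y) <= normc x + normc y.
Proof. exact: le_normcD. Qed.

Lemma normc_opp x : normc (- x) = normc x.
Proof. exact: normcN. Qed.

Lemma normc_distC x y : normc (x - y) = normc (y - x).
Proof. by rewrite -normc_opp opprB. Qed.

Lemma normc_mul x y : normc (x * y) = normc x * normc y.
Proof. exact: normcM. Qed.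

Lemma normc_dist_trans y x z : normc (x - z) <= normc (x - y) + normc (y - z).
Proof. by apply: le_trans (normc_leD _ _); rewrite addrA subrK. Qed.

Lemma normc_sum (I : Type) (r : seq I) (F : I -> R[i]) :
  normc (\sum_(i <- r) F i) <= \sum_(i <- r) normc (F i).
Proof.
elim/big_ind2 : _ => [|x a y b xa yb|//]; first by rewrite normc0.
by apply: le_trans (normc_leD _ _) _; exact: lerD.
Qed.

Lemma normc_ge_Re z : `|complex.Re z| <= normc z.
Proof.
by case: z => a b /=; rewrite -sqrtr_sqr ler_wsqrtr // lerDl sqr_ge0.
Qed.

Lemma normc_ge_Im z : `|complex.Im z| <= normc z.
Proof.
by case: z => a b /=; rewrite -sqrtr_sqr ler_wsqrtr // lerDr sqr_ge0.
Qed.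

Lemma normc_le_ReIm z : normc z <= `|complex.Re z| + `|complex.Im z|.
Proof.
case: z => a b /=; rewrite -[leRHS]ger0_norm ?addr_ge0 // -sqrtr_sqr.
rewrite ler_wsqrtr // sqrrD !real_normK ?num_real // -addrA lerD2l lerDr.
by rewrite mulrn_wge0 // mulr_ge0.
Qed.

Lemma nbhs_normc z (P : set R[i]) : nbhs z P ->
  exists2 e : R, 0 < e & forall y, normc (y - z) < e -> P y.
Proof.
move=> /nbhs_ballP [[a b] /=]; rewrite ltcE /= => /andP[/eqP b0 a0] H.
exists a => // y ya; apply: H.
by rewrite /ball /= /ball_ /= distrC normr_normc ltcE /= b0 eqxx.
Qed.

End ComplexModulus.

(** * Entrywise closeness of tuples and the product topology *)

Definition close (R : realType) (d n m : nat) (e : R)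
    (A B : 'I_d -> 'M[R[i]]_(n, m)) : Prop :=
  forall i j k, normc (A i j k - B i j k) < e.

Section Close.
Variables (R : realType) (d n m : nat).
Implicit Types A B C : 'I_d -> 'M[R[i]]_(n, m).

Lemma close_refl e A : 0 < e -> close e A A.
Proof. by move=> e0 i j k; rewrite subrr normc0. Qed.

Lemma close_sym e A B : close e A B -> close e B A.
Proof. by move=> AB i j k; rewrite normc_distC. Qed.

Lemma close_trans B e1 e2 A C :
  close e1 A B -> close e2 B C -> close (e1 + e2) A C.
Proof.
move=> AB BC i j k; apply: le_lt_trans (normc_dist_trans (B i j k) _ _) _.
exact: ltrD.
Qed.

Lemma close_le e1 e2 A B : e1 <= e2 -> close e1 A B -> close e2 A B.
Proof. by move=> e12 AB i j k; exact: lt_le_trans (AB i j k) e12. Qed.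

Lemma close_eq A B : (forall e, 0 < e -> close e A B) -> A = B.
Proof.
move=> AB; apply: funext => i; apply/matrixP => j k.
apply/eqP; rewrite -subr_eq0; apply/eqP/eq0_normc/eqP.
rewrite eq_le normc_ge0 andbT; apply/ler_addgt0Pl => e e0.
by rewrite addr0; exact/ltW/AB.
Qed.

Lemma bounded_tuple A :
  exists2 K : R, 0 < K & forall i j k, normc (A i j k) < K.
Proof.
pose a (x : 'I_d * 'I_n * 'I_m) := normc (A x.1.1 x.1.2 x.2).
have a0 P : 0 <= \sum_(x | P x) a x by apply: sumr_ge0 => x _; exact: normc_ge0.
exists (1 + \sum_x a x) => [|i j k]; first by rewrite ltr_wpDr.
rewrite (bigD1 (i, j, k)) //= addrA [1 + _]addrC -addrA ltrDl.
by rewrite ltr_wpDr.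
Qed.

End Close.

(** The filter generated by the entrywise neighbourhoods of X converges to X, because each
    coordinate of the product involves only finitely many entries. *)
Lemma open_close (R : realType) (d n : nat) (W : set (mtuple R d n)) X :
  open W -> W X -> exists2 r : R, 0 < r & forall Y, close r Y X -> W Y.
Proof.
move=> oW WX; have nW : nbhs X W by exact: open_nbhs_nbhs.
pose F : set_system (mtuple R d n) := filter_from [set r : R | 0 < r]
  (fun r => [set Y : mtuple R d n | close r Y X]).
have FF : Filter F.
  apply: filter_from_filter; first by exists 1 => /=.
  move=> a b /= a0 b0; exists (Num.min a b) => /=; first by rewrite lt_min a0.
  by move=> Y YX; split; apply: close_le YX; rewrite ge_min lexx ?orbT.
suff FX : F --> (X : mtuple R d n) by have [r r0 rW] := FX _ nW; exists r.
apply/cvg_sup => i A [B] [[C oC <-] CX CA].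
have [P nP PC] : nbhs (X i) C by exact: open_nbhs_nbhs.
have /choice [e eP] : forall jk : 'I_n * 'I_n, exists e : R,
    0 < e /\ forall y, normc (y - X i jk.1 jk.2) < e -> P jk.1 jk.2 y.
  by case=> j k /=; have [e e0 eP] := nbhs_normc (nP j k); exists e.
(* The start value 1 keeps the radius positive when there are no entries. *)
exists (\big[Num.min/1]_jk e jk) => /=.
  by elim/big_ind : _ => // [a b a0 b0|jk _];
    [rewrite lt_min a0|exact: (eP jk).1].
move=> Y YX; apply/CA/PC => j k; apply: (eP (j, k)).2 => /=.
apply: (lt_le_trans (YX i j k)); exact: (bigmin_le 1 (j, k) e).
Qed.

(** * Limits along an ultrafilter *)

Section UltraLimit.
Variables (R : realType) (U : set_system nat).
Context {UU : UltraFilter U}.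

Definition ultra_cvg (d n m : nat) (Z : nat -> 'I_d -> 'M[R[i]]_(n, m))
    (W : 'I_d -> 'M[R[i]]_(n, m)) : Prop :=
  forall e, 0 < e -> U [set p | close e (Z p) W].

(** Compactness of the segment gives a cluster point x of [u @ U]. If the indices with [u p] near x
    did not form a set of U, their complement would, against clustering at x. *)
Lemma ultra_cvg_real (u : nat -> R) (K : R) : (forall p, `|u p| <= K) ->
  exists x, forall e, 0 < e -> U [set p | `|u p - x| < e].
Proof.
move=> uK; have [|x [_ xU]] := @segment_compact R (- K) K (u @ U) _.
  by rewrite /nbhs /=; apply: filterE => p /=; rewrite in_itv /= -ler_norml.
exists x => e e0; have [//|nU] := in_ultra_setVsetC [set p | `|u p - x| < e] UU.
have uU : (u @ U) [set u p | p in ~` [set p | `|u p - x| < e]].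
  by apply: (@filterS _ U _ _ _ _ nU) => p pe /=; exists p.
have [y [[q /= qe <-] xq]] := xU _ _ uU (nbhsx_ballx x e e0).
by case: qe; move: xq; rewrite /ball /= distrC.
Qed.

Variables (d n m : nat).
Implicit Types Z : nat -> 'I_d -> 'M[R[i]]_(n, m).

Lemma ultra_cvg_exists Z (K : R) :
  (forall p i j k, normc (Z p i j k) <= K) -> exists W, ultra_cvg Z W.
Proof.
move=> ZK.
have /choice [w wP] : forall ijk : 'I_d * 'I_n * 'I_m, exists w : R[i],
    forall e, 0 < e -> U [set p | normc (Z p ijk.1.1 ijk.1.2 ijk.2 - w) < e].
  move=> [[i j] k] /=.
  have [|x xP] := @ultra_cvg_real (fun p => complex.Re (Z p i j k)) K.
    by move=> p; exact: le_trans (normc_ge_Re _) (ZK _ _ _ _).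
  have [|y yP] := @ultra_cvg_real (fun p => complex.Im (Z p i j k)) K.
    by move=> p; exact: le_trans (normc_ge_Im _) (ZK _ _ _ _).
  exists (x +i* y)%C => e e0; have e20 : 0 < e / 2 by rewrite divr_gt0.
  apply: filterS2 (xP _ e20) (yP _ e20) => p /= px py.
  apply: le_lt_trans (normc_le_ReIm _) _.
  by rewrite [e]splitr; case: (Z p i j k) px py => a b /= px py; exact: ltrD.
exists (fun i => \matrix_(j, k) w (i, j, k)) => e e0.
have FU : Filter U by typeclasses eauto.
have := @filter_forall _ _ (fun ijk : 'I_d * 'I_n * 'I_m =>
  [set p | normc (Z p ijk.1.1 ijk.1.2 ijk.2 - w ijk) < e]) U FU
  (fun ijk => wP ijk e e0).
apply: (@filterS _ U) => p /= pe i j k.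
by rewrite mxE; exact: (pe (i, j, k)).
Qed.

Lemma ultra_cvg_unique Z W W' : ultra_cvg Z W -> ultra_cvg Z W' -> W = W'.
Proof.
move=> ZW ZW'; apply: close_eq => e e0.
have e20 : 0 < e / 2 by rewrite divr_gt0.
have [p /= [pW pW']] := filter_ex (filterI (ZW _ e20) (ZW' _ e20)).
by rewrite [e]splitr; exact: close_trans (close_sym pW) pW'.
Qed.

End UltraLimit.

(** * Convex combinations and shears of tuples *)

Section Tuples.
Variables (R : realType) (d : nat).

Definition tuple_mix (n m : nat) (t : R) (X Y : 'I_d -> 'M[R[i]]_(n, m)) :
    'I_d -> 'M[R[i]]_(n, m) :=
  fun i => (1 - t)%:C%C *: X i + t%:C%C *: Y i.

Definition tuple_tri (n m : nat) (X : mtuple R d n.+1)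
    (H : 'I_d -> 'M[R[i]]_(n.+1, m.+1)) (Y : mtuple R d m.+1) :
    mtuple R d (n + m.+1).+1 :=
  fun i => block_mx (X i) (H i) 0 (Y i).

Definition shear_mx (n m : nat) (L : 'M[R[i]]_(n.+1, m.+1)) :
    'M[R[i]]_(n.+1 + m.+1) :=
  block_mx 1%:M L 0 1%:M.

Definition shear (n m : nat) (L : 'M[R[i]]_(n.+1, m.+1)) (X : mtuple R d n.+1)
    (Y : mtuple R d m.+1) : mtuple R d (n + m.+1).+1 :=
  tuple_tri X (fun i => X i *m L - L *m Y i) Y.

Lemma shear_mxM n m (L L' : 'M[R[i]]_(n.+1, m.+1)) :
  shear_mx L *m shear_mx L' = shear_mx (L + L').
Proof.
rewrite /shear_mx (@mulmx_block _ n.+1 m.+1 n.+1 m.+1 n.+1 m.+1).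
by rewrite !mulmx0 !mul0mx !mul1mx !mulmx1 !addr0 add0r addrC.
Qed.

Lemma shear_mx0 n m : shear_mx (0 : 'M[R[i]]_(n.+1, m.+1)) = 1%:M.
Proof. by rewrite /shear_mx -(@scalar_mx_block _ n.+1 m.+1). Qed.

Lemma shear_mx_unit n m (L : 'M[R[i]]_(n.+1, m.+1)) : shear_mx L \in unitmx.
Proof.
by have /mulmx1_unit[] : shear_mx L *m shear_mx (- L) = 1%:M
  by rewrite shear_mxM subrr shear_mx0.
Qed.

Lemma invmx_shear n m (L : 'M[R[i]]_(n.+1, m.+1)) :
  invmx (shear_mx L) = shear_mx (- L).
Proof.
rewrite -[LHS]mulmx1 -(shear_mx0 n m) -(subrr L) -shear_mxM.
by rewrite mulKmx ?shear_mx_unit.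
Qed.

Lemma shear_sim n m (L : 'M[R[i]]_(n.+1, m.+1)) X Y :
  tuple_sim (shear_mx L) (tuple_dsum X Y) = shear L X Y.
Proof.
apply: funext => i; rewrite /tuple_sim /tuple_dsum invmx_shear /shear_mx.
rewrite !(@mulmx_block _ n.+1 m.+1 n.+1 m.+1 n.+1 m.+1).
by rewrite !(mulmx0, mul0mx, mul1mx, mulmx1, addr0, add0r) mulNmx.

Qed.

Lemma shear0 n m X Y :
  shear (0 : 'M[R[i]]_(n.+1, m.+1)) X Y = tuple_dsum X Y.
Proof.
by apply: funext => i; rewrite /shear /tuple_tri mulmx0 mul0mx subrr.
Qed.

(** Scalars commute with X, so the corner vanishes for every c: in convex combinations this tuple
    serves as an interior base point. *)
Lemma shear_scalar_diag n c (X : mtuple R d n.+1) :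
  shear (c%:M : 'M[R[i]]_n.+1) X X = tuple_dsum X X.
Proof.
apply: funext => i; rewrite /shear /tuple_tri scalar_mxC subrr. by [].
Qed.

Lemma tuple_mix_id n m t (X : 'I_d -> 'M[R[i]]_(n, m)) : tuple_mix t X X = X.
Proof.
by apply: funext => i; rewrite /tuple_mix -scalerDl -rmorphD subrK scale1r.
Qed.

(** For fixed L the corner is linear in the pair of diagonal blocks. *)
Lemma shear_mix n m (L : 'M[R[i]]_(n.+1, m.+1)) t X X' Y Y' :
  shear L (tuple_mix t X X') (tuple_mix t Y Y') =
  tuple_mix t (shear L X Y) (shear L X' Y').
Proof.
apply: funext => i; rewrite /shear /tuple_tri /tuple_mix.
rewrite !(@scale_block_mx _ n.+1 m.+1 n.+1 m.+1).
rewrite (@add_block_mx _ n.+1 m.+1 n.+1 m.+1) !scaler0 addr0.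
rewrite mulmxDl mulmxDr -!scalemxAl -!scalemxAr !scalerBr opprD.
by rewrite [in LHS]addrACA.
Qed.

Lemma dsum_mix n m t (X X' : mtuple R d n.+1) (Y Y' : mtuple R d m.+1) :
  tuple_dsum (tuple_mix t X X') (tuple_mix t Y Y') =
  tuple_mix t (tuple_dsum X Y) (tuple_dsum X' Y').
Proof. by rewrite -!(shear0 X) -!(shear0 X') -shear0 shear_mix. Qed.

Lemma sim_mix n t S (X Y : mtuple R d n) :
  tuple_sim S (tuple_mix t X Y) = tuple_mix t (tuple_sim S X) (tuple_sim S Y).
Proof.
apply: funext => i; rewrite /tuple_sim /tuple_mix.
by rewrite mulmxDr mulmxDl -!scalemxAr -!scalemxAl.
Qed.

Lemma close_tri n m e (X X' : mtuple R d n.+1) (Y Y' : mtuple R d m.+1) H H' :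
  close e X X' -> close e H H' -> close e Y Y' -> 0 < e ->
  close e (tuple_tri X H Y) (tuple_tri X' H' Y').
Proof.
move=> XX' HH' YY' e0 i.
(* Retyping the indices exposes the sum n.+1 + m.+1 behind the convertible dimension (n + m.+1).+1,
   so that they can be split into blocks. *)
suff : forall j k : 'I_(n.+1 + m.+1),
    normc (block_mx (X i) (H i) 0 (Y i) j k -
      block_mx (X' i) (H' i) 0 (Y' i) j k) < e by [].
move=> j k.
rewrite -(fintype.splitK j) -(fintype.splitK k).
case: (fintype.split j) => a; case: (fintype.split k) => b /=.
- by rewrite !block_mxEul; exact: XX'.
- by rewrite !block_mxEur; exact: HH'.
- by rewrite !block_mxEdl !mxE subrr normc0.
- by rewrite !block_mxEdr; exact: YY'.
Qed.

End Tuples.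

(** * Convexity of the levels of a matrix convex set *)

Lemma adj_real_scalar_mx (R : realType) n (a : R) :
  (a%:C%C%:M : 'M[R[i]]_n)^t* = a%:C%C%:M.
Proof.
rewrite tr_scalar_mx map_scalar_mx /=; congr (_%:M); exact: conjc_real.
Qed.

Section MatrixConvex.
Variables (R : realType) (d : nat) (Omega : nc_family R d).
Hypothesis Omega_convex : matrix_convex Omega.

(** The combination is the compression of the direct sum of X and Y by the isometric column with
    scalar blocks sqrt (1 - t) and sqrt t. *)
Lemma matrix_convex_mix n (t : R) (X Y : mtuple R d n.+1) :
  0 <= t <= 1 -> Omega X -> Omega Y ->
  Omega (tuple_mix t X Y : mtuple R d n.+1).
Proof.
case: Omega_convex => dsum compr /andP[t0 t1] OX OY.
pose V : 'M[R[i]]_(n.+1 + n.+1, n.+1) :=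
  col_mx (Num.sqrt (1 - t))%:C%C%:M (Num.sqrt t)%:C%C%:M.
have Vadj : V^t* = row_mx (Num.sqrt (1 - t))%:C%C%:M (Num.sqrt t)%:C%C%:M.
  by rewrite /V tr_col_mx map_row_mx !adj_real_scalar_mx.
have sq (s : R) : 0 <= s -> (Num.sqrt s)%:C%C * (Num.sqrt s)%:C%C = s%:C%C.
  by move=> s0; rewrite -rmorphM -expr2 sqr_sqrtr.
have VV : isometry_mx V.
  rewrite /isometry_mx Vadj /V mul_row_col.
  rewrite -!scalar_mxM !sq ?subr_ge0 //  -raddfD /=.
  by rewrite -rmorphD subrK.
suff -> : tuple_mix t X Y =
    tuple_compr V (tuple_dsum X Y : mtuple R d (n.+1 + n.+1)).
  by apply: (compr (n + n.+1)%N n V) => //; exact: dsum.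
apply: funext => i; rewrite /tuple_compr /tuple_dsum Vadj /V /tuple_mix.
rewrite mul_row_block !mulmx0 addr0 add0r mul_row_col.
rewrite !mul_scalar_mx -!scalemxAl !mul_mx_scalar !scalerA.
by rewrite !sq ?subr_ge0.
Qed.

(** D lies on a segment from A to a point B' with t (B' - B) = D - ((1 - t) A + t B), so B' is
    within r of B. The radius shrinks by the factor t only, wherever A lies in Omega. *)
Lemma matrix_convex_ball n (t r : R) (A B D : mtuple R d n.+1) :
  0 < t <= 1 -> (forall Y, close r Y B -> Omega Y) -> Omega A ->
  close (t * r) D (tuple_mix t A B) -> Omega D.
Proof.
move=> /andP[t0 t1] OB OA DAB.
pose B' : mtuple R d n.+1 :=
  fun i => (t^-1)%:C%C *: (D i - (1 - t)%:C%C *: A i).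
have -> : D = tuple_mix t A B'.
  apply: funext => i; rewrite /tuple_mix /B' scalerA -rmorphM divff ?gt_eqF //.
  by rewrite scale1r addrC subrK.
apply: matrix_convex_mix; rewrite ?(ltW t0) //; apply: OB => i j k.
have -> : B' i j k - B i j k = (t^-1)%:C%C * (D i j k - tuple_mix t A B i j k).
  rewrite /B' /tuple_mix !mxE opprD addrA [RHS]mulrBr mulrA -rmorphM.
  by rewrite mulVf ?gt_eqF // mul1r.
rewrite normc_mul normc_real gtr0_norm ?invr_gt0 //.
by rewrite mulrC ltr_pdivrMr // mulrC; exact: DAB.
Qed.

End MatrixConvex.

(** * Entry bounds from the operator norm *)

Section OperatorNorm.
Variable R : realType.

Lemma normc_le_l2norm n (v : 'cV[R[i]]_n) j : normc (v j 0) <= l2norm v.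
Proof.
rewrite -[leLHS]ger0_norm ?normc_ge0 // -sqrtr_sqr ler_wsqrtr //.
by rewrite (bigD1 j) //= lerDl sumr_ge0 // => k _; exact: sqr_ge0.
Qed.

Lemma l2norm_le n (v : 'cV[R[i]]_n) (b : 'I_n -> R) :
  (forall j, normc (v j 0) <= b j) -> l2norm v <= Num.sqrt (\sum_j b j ^+ 2).
Proof.
move=> vb; rewrite ler_wsqrtr //; apply: ler_sum => j _.
by rewrite ler_sqr ?nnegrE ?(le_trans _ (vb j)) ?normc_ge0.
Qed.

Lemma normc_le_opnorm n (A : 'M[R[i]]_n) j k : normc (A j k) <= opnorm A.
Proof.
have -> : A j k = (A *m delta_mx k 0 : 'cV_n) j 0.
  by rewrite -colE mxE.
apply: le_trans (normc_le_l2norm _ j) _; apply: ub_le_sup; last first.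
  exists (delta_mx k 0) => //=.
  rewrite /l2norm (bigD1 k) //= big1 => [|l lk].
    by rewrite mxE !eqxx normc1 expr1n addr0 sqrtr1.
  by rewrite mxE (negbTE lk) normc0 expr0n.
(* The supremum dominates its set only once the set is known to be bounded; entries of v have
   modulus at most 1, so row sums of moduli give a bound. *)
exists (Num.sqrt (\sum_l (\sum_i normc (A l i)) ^+ 2)) => _ [v /= v1 <-].
apply: l2norm_le => l; rewrite mxE; apply: le_trans (normc_sum _ _) _.
apply: ler_sum => i _; rewrite normc_mul ler_piMr ?normc_ge0 //.
exact: le_trans (normc_le_l2norm _ _) v1.
Qed.

Lemma nc_bounded_entries d (Omega : nc_family R d) : nc_bounded Omega ->
  exists2 K : R, 0 < K &
    forall n (X : mtuple R d n.+1) i j k, Omega n X -> normc (X i j k) <= K.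
Proof.
(* The maximum with 1 makes the bound positive, so that it can be divided by. *)
move=> [M MP]; exists (Num.max 1 M) => [|n X i j k OX].
  by rewrite lt_max ltr01.
by rewrite le_max (le_trans (normc_le_opnorm _ j k) (MP _ _ _ OX)) orbT.
Qed.

End OperatorNorm.

(** * Shears under an nc map, and continuity *)

Section NCMap.
Variables (R : realType) (d : nat) (Omega : nc_family R d).
Hypothesis Omega_open : nc_open Omega.
Hypothesis Omega_convex : matrix_convex Omega.
Variable K : R.
Hypothesis K0 : 0 < K.
Hypothesis Omega_le : forall n (X : mtuple R d n.+1) i j k,
  Omega X -> normc (X i j k) <= K.
Variable f : nc_function R d.
Hypothesis f_nc : nc_map Omega f.

Lemma nc_map_shear n m (L : 'M[R[i]]_(n.+1, m.+1)) X Y :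
  Omega X -> Omega Y -> Omega (shear L X Y) ->
  f (shear L X Y) = shear L (f X) (f Y).
Proof.
case: Omega_convex => dsum _; case: f_nc => _ fD fS OX OY.
rewrite -shear_sim => OS; rewrite fS ?fD //;
  [exact: shear_sim|exact: shear_mx_unit|exact: dsum].
Qed.

Lemma shear_le n m (L : 'M[R[i]]_(n.+1, m.+1)) X Y i j k :
  Omega (shear L X Y) -> normc ((X i *m L - L *m Y i) j k) <= K.
Proof.
move=> /(Omega_le i (lshift m.+1 j) (rshift n.+1 k)).
suff -> : shear L X Y i (lshift m.+1 j) (rshift n.+1 k) =
  (X i *m L - L *m Y i) j k by [].
exact: block_mxEur.
Qed.

Lemma shear_scalarE n (c : R) (A B : 'M[R[i]]_n) j k :
  (A *m c%:C%C%:M - c%:C%C%:M *m B) j k = c%:C%C * (A j k - B j k).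
Proof. by rewrite mul_scalar_mx mul_mx_scalar !mxE mulrBr. Qed.

(** The corner is c (X - Y) and its entries are bounded by K: membership in Omega for a large c
    forces X and Y to be close. *)
Lemma shear_scalar_le n (c : R) (X Y : mtuple R d n.+1) i j k : 0 < c ->
  Omega (shear (c%:C%C%:M : 'M[R[i]]_n.+1) X Y) ->
  normc (X i j k - Y i j k) <= K / c.
Proof.
move=> c0 /(shear_le i j k); rewrite shear_scalarE normc_mul normc_real.
by rewrite gtr0_norm // ler_pdivlMr // mulrC.
Qed.

(** At c = 0 the shear is the direct sum of X and Y, an interior point of Omega. *)
Lemma shear_small n m (L : 'M[R[i]]_(n.+1, m.+1)) X Y : Omega X -> Omega Y ->
  exists2 c : R, 0 < c & Omega (shear (c%:C%C *: L) X Y).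
Proof.
case: Omega_convex => dsum _ OX OY.
have [r r0 Or] := open_close (@Omega_open _) (dsum _ _ _ _ OX OY).
have [B B0 HB] := bounded_tuple (fun i => X i *m L - L *m Y i).
exists (r / B); first exact: divr_gt0.
apply: Or; rewrite -shear0.
apply: close_tri; [exact: close_refl| |exact: close_refl|by []].
move=> i j k; rewrite mulmx0 mul0mx subrr [X in _ - X]mxE subr0.
rewrite -scalemxAl -scalemxAr -scalerBr mxE normc_mul normc_real.
rewrite gtr0_norm ?divr_gt0 // mulrAC ltr_pdivrMr // ltr_pM2l //.
Qed.

(** For Z near W the shear of (Z, W) by c is near the direct sum of W with itself, hence in Omega.
    Its image has corner c (f Z - f W), bounded by K. *)
Lemma nc_map_continuous n (W : mtuple R d n.+1) (e : R) : Omega W -> 0 < e ->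
  exists2 r : R, 0 < r &
    forall Z, close r Z W -> Omega Z /\ close e (f Z) (f W).
Proof.
case: Omega_convex => dsum _; case: f_nc => fO _ _ OW e0.
have [r1 r10 Or1] := open_close (@Omega_open _) OW.
have [r r0 Or] := open_close (@Omega_open _) (dsum _ _ _ _ OW OW).
(* K + 1 instead of K makes the final bound K / c strictly smaller than e. *)
pose c := (K + 1) / e; have c0 : 0 < c by rewrite divr_gt0 // addr_gt0.
exists (Num.min r1 (Num.min r (r / c))) => [|Z ZW].
  by rewrite !lt_min r10 r0 divr_gt0.
have OZ : Omega Z by apply: Or1; apply: close_le ZW; rewrite ge_min lexx.
split=> // i j k.
have OS : Omega (shear (c%:C%C%:M : 'M[R[i]]_n.+1) Z W).
  apply: Or; rewrite -shear0.
  apply: close_tri; [|  |exact: close_refl|by []].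
    by apply: close_le ZW; rewrite !ge_min lexx orbT.
  move=> i' j' k'; rewrite mulmx0 mul0mx subrr [X in _ - X]mxE subr0.
  rewrite shear_scalarE normc_mul normc_real gtr0_norm // mulrC -ltr_pdivlMr //.
  by apply: lt_le_trans (ZW i' j' k') _; rewrite !ge_min lexx !orbT.
have := fO _ _ OS; rewrite nc_map_shear // => /(shear_scalar_le i j k c0).
move=> /le_lt_trans; apply.
by rewrite ltr_pdivrMr // /c mulrCA divff ?gt_eqF // mulr1 ltrDl.
Qed.

(** * The relaxed iteration and its approximate fixed points *)

Definition relax n (t : R) (X Z : mtuple R d n.+1) : mtuple R d n.+1 :=
  tuple_mix t (f Z) X.

(** The anchor X is also the starting point, so the iteration involves no choice and leaves fixed
    points of f where they are. *)
Definition relax_iter n (t : R) (X : mtuple R d n.+1) (k : nat) :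
    mtuple R d n.+1 := iter k (relax t X) X.

Lemma relax_in n t (X Z : mtuple R d n.+1) : 0 <= t <= 1 ->
  Omega X -> Omega Z -> Omega (relax t X Z).
Proof.
by case: f_nc => fO _ _ t01 OX OZ; apply: matrix_convex_mix => //; exact: fO.
Qed.

Lemma relax_iter_in n t (X : mtuple R d n.+1) k : 0 <= t <= 1 ->
  Omega X -> Omega (relax_iter t X k).
Proof. by move=> t01 OX; elim: k => //= k IH; exact: relax_in. Qed.

(* Since [shear _ X X] is the interior point X (+) X, the image of a shear under
   the relaxed map stays in Omega after a further small stretching. *)
Lemma relax_contract n (t r c : R) (X Y Z : mtuple R d n.+1) :
  0 < r -> (forall T, close r T (tuple_dsum X X) -> Omega T) ->
  0 < t <= 1 -> Omega Y -> Omega Z ->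
  Omega (shear (c%:C%C%:M : 'M[R[i]]_n.+1) Y Z) ->
  Omega (shear (((1 + t * r / (2 * K)) * c)%:C%C%:M : 'M[R[i]]_n.+1)
    (relax t X Y) (relax t X Z)).
Proof.
move=> r0 OX /andP[t0 t1] OY OZ OS; case: f_nc => fO _ _.
have OfS := fO _ _ OS; rewrite nc_map_shear // in OfS.
have OX' : Omega (tuple_dsum X X) by apply: OX; exact: close_refl.
apply: (matrix_convex_ball Omega_convex _ OX OfS (t := t)); first by rewrite t0.
rewrite -(shear_scalar_diag c%:C%C) -shear_mix.
have tr0 : 0 < t * r by rewrite mulr_gt0.
apply: close_tri; [exact: close_refl| |exact: close_refl|by []].
move=> i j k; rewrite !shear_scalarE -mulrBl -rmorphB mulrDl mul1r.
rewrite addrAC subrr add0r rmorphM -mulrA normc_mul normc_real.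
rewrite gtr0_norm ?divr_gt0 ?mulr_gt0 //.
have trE : t * r = t * r / (2 * K) * (2 * K).
  by rewrite divfK // gt_eqF // mulr_gt0.
rewrite [ltRHS]trE ltr_pM2l ?divr_gt0 ?mulr_gt0 //.
(* The unstretched shear already lies in Omega, so its corner is at most K; the 2 in the stretching
   factor turns this into a strict bound. *)
have /(shear_le i j k) : Omega (shear (c%:C%C%:M : 'M[R[i]]_n.+1)
    (relax t X Y) (relax t X Z)).
  rewrite shear_mix shear_scalar_diag.
  by apply: matrix_convex_mix => //; rewrite ltW.
rewrite shear_scalarE => /le_lt_trans; apply.
by rewrite mulr_natl mulr2n ltrDl.
Qed.

Lemma bernoulli_le (x : R) k : 0 <= x -> 1 + k%:R * x <= (1 + x) ^+ k.
Proof.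
move=> x0; elim: k => [|k IH]; first by rewrite mul0r addr0.
rewrite exprS; apply: le_trans (ler_wpM2l _ IH); last by rewrite addr_ge0.
rewrite -natr1; have : 0 <= k%:R * x * x by rewrite !mulr_ge0.
by lra.
Qed.

(** By induction the shear of two consecutive iterates by q ^+ k * c stays in Omega, which bounds
    their difference by K / (q ^+ k * c). Bernoulli's inequality then trades the power for a bound
    linear in k. *)
Lemma relax_iter_step n (t r c : R) (X : mtuple R d n.+1) k i j l :
  0 < r -> (forall T, close r T (tuple_dsum X X) -> Omega T) -> 0 < t <= 1 ->
  Omega X -> 0 < c -> Omega (shear (c%:C%C%:M : 'M[R[i]]_n.+1) (f X) X) ->
  normc (relax_iter t X k.+1 i j l - relax_iter t X k i j l) <=
    K / ((1 + k%:R * (t * r / (2 * K))) * c).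
Proof.
move=> r0 OT t01 OX c0 OS; have t01' : 0 <= t <= 1.
  by case/andP: t01 => /ltW -> ->.
set q := 1 + t * r / (2 * K).
have q0 : 0 <= t * r / (2 * K).
  by case/andP: t01 => t0 _; rewrite divr_ge0 // mulr_ge0 // ltW.
have Ok : Omega (shear ((q ^+ k * c)%:C%C%:M : 'M[R[i]]_n.+1)
    (relax_iter t X k.+1) (relax_iter t X k)).
  elim: k => [|k IH] /=.
    (* Writing X as a combination of X with itself exhibits the first shear as a combination of the
       given shear of (f X, X) and the direct sum of X with itself. *)
    rewrite mul1r -[X in shear _ _ X](tuple_mix_id t X) shear_mix.
    apply: matrix_convex_mix => //; rewrite shear_scalar_diag.
    by case: Omega_convex => dsum _; exact: dsum.
  rewrite exprS -mulrA.
  by apply: relax_contract => //; [exact: (@relax_iter_in _ _ _ k.+1)|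
    exact: relax_iter_in].
have qk : 0 < 1 + k%:R * (t * r / (2 * K)).
  by rewrite ltr_pwDl // mulr_ge0.
have qk' := bernoulli_le k q0.
have qk0 : 0 < q ^+ k := lt_le_trans qk qk'.
apply: le_trans (shear_scalar_le _ _ _ _ Ok) _; first by rewrite mulr_gt0.
by rewrite ler_pM2l // lef_pV2 ?posrE ?mulr_gt0 // ler_pM2r.
Qed.

(** After k steps consecutive iterates differ by O(1 / (k t)). With t = 1 / (p + 1), taking k = (p +
    1)^2 makes this O(1 / (p + 1)), the order of the relaxation error. *)
Definition relax_seq n (X : mtuple R d n.+1) (p : nat) : mtuple R d n.+1 :=
  relax_iter p.+1%:R^-1 X (p.+1 * p.+1).

Lemma relax_weight p : 0 < (p.+1%:R^-1 : R) <= 1.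
Proof. by rewrite invr_gt0 ltr0n /= invf_le1 ?ltr0n // ler1n. Qed.

Lemma relax_weight_ge0 p : 0 <= (p.+1%:R^-1 : R) <= 1.
Proof. by case/andP: (relax_weight p) => /ltW -> ->. Qed.

Lemma relax_seq_in n (X : mtuple R d n.+1) p : Omega X -> Omega (relax_seq X p).
Proof. by move=> OX; apply: relax_iter_in => //; exact: relax_weight_ge0. Qed.

Lemma relax_seq_fixed n (X : mtuple R d n.+1) p : f X = X -> relax_seq X p = X.
Proof.
rewrite /relax_seq /relax_iter => fX.
by elim: (p.+1 * p.+1)%N => //= k ->; rewrite /relax fX tuple_mix_id.
Qed.

Lemma relax_seq_approx n (X : mtuple R d n.+1) : Omega X ->
  exists2 C : R, 0 < C & forall p i j k,
    normc (f (relax_seq X p) i j k - relax_seq X p i j k) <= C / p.+1%:R.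
Proof.
move=> OX; case: (Omega_convex) => dsum _; case: (f_nc) => fO _ _.
have [r r0 Or] := open_close (@Omega_open _) (dsum _ _ _ _ OX OX).
have [c c0] := shear_small 1%:M (fO _ _ OX) OX.
rewrite scalemx1 => Oc.
(* The first summand bounds the last step of the iteration, the second bounds f Z - F_t(Z) = t (f Z
   - X). *)
exists (2 * K ^+ 2 / (r * c) + 2 * K) => [|p i j k].
  by rewrite addr_gt0 ?divr_gt0 ?mulr_gt0 ?exprn_gt0.
set t : R := p.+1%:R^-1; have [t0 t1] := andP (relax_weight p).
set Z := relax_seq X p.
have OZ : Omega Z by exact: relax_seq_in.
rewrite mulrDl [leRHS]addrC.
apply: le_trans (normc_dist_trans (relax t X Z i j k) _ _) _.
apply: lerD.
  have -> : f Z i j k - relax t X Z i j k = t%:C%C * (f Z i j k - X i j k).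
    by rewrite /relax /tuple_mix !mxE rmorphB rmorph1; ring.
  rewrite normc_mul normc_real gtr0_norm // [leRHS]mulrC ler_pM2l //.
  rewrite mulr_natl mulr2n; apply: le_trans (normc_leD _ _) _.
  by rewrite normc_opp lerD // Omega_le //; exact: fO.
have := relax_iter_step (p.+1 * p.+1) i j k r0 Or (relax_weight p) OX c0 Oc.
rewrite -/(relax_seq X p) => /le_trans; apply.
have p0 : (0 : R) < p.+1%:R by rewrite ltr0n.
have u0 : 0 < p.+1%:R * (r / (2 * K)) * c.
  by do 2 apply: mulr_gt0 => //; rewrite divr_gt0 // mulr_gt0.
have E1 (a : R) : 0 < a ->
    2 * K ^+ 2 / (r * c) / a = K / (a * (r / (2 * K)) * c).
  by move=> a0; field; rewrite (gt_eqF a0) (gt_eqF K0) (gt_eqF r0) (gt_eqF c0).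
have E2 (a : R) : 0 < a -> a * a * (a^-1 * r / (2 * K)) = a * (r / (2 * K)).
  by move=> a0; field; rewrite (gt_eqF a0) (gt_eqF K0).
rewrite natrM E1 // E2 // ler_pM2l // lef_pV2 ?posrE // ?mulr_gt0 //.
  by rewrite ler_pM2r // lerDr.
by rewrite ltr_pwDl // ltW // mulr_gt0 // divr_gt0 // mulr_gt0.
Qed.

(** * Limits of the iteration stay in Omega and are fixed *)

Lemma unit_circle_slope (c : R) : 0 < c ->
  exists a b : R, [/\ 0 < a, a ^+ 2 + b ^+ 2 = 1 & a < b * c].
Proof.
move=> c0; pose b := (Num.sqrt (1 + (c / 2) ^+ 2))^-1.
have D0 : 0 < 1 + (c / 2) ^+ 2 by rewrite ltr_pwDl // sqr_ge0.
have b0 : 0 < b by rewrite invr_gt0 sqrtr_gt0.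
exists (b * (c / 2)), b; split; first by rewrite mulr_gt0 // divr_gt0.
  rewrite exprMn; have -> : b ^+ 2 = (1 + (c / 2) ^+ 2)^-1.
    by rewrite exprVn sqr_sqrtr ?ltW.
  by rewrite -{2}[_^-1]mulr1 -mulrDr [_ + 1]addrC mulVf // gt_eqF.
by rewrite ltr_pM2l // ltr_pdivrMr // ltr_pMr // ltr1n.
Qed.

(** Since P = (1 - t) f(P) + t P, the shear of (P, F_t(Z)) is a combination of f applied to the
    shear of (P, Z) and of the given shear of (P, X). The same L thus works for all k and t. *)
Lemma relax_iter_shear N n (L : 'M[R[i]]_(N.+1, n.+1)) P X t k :
  Omega P -> f P = P -> 0 <= t <= 1 -> Omega X -> Omega (shear L P X) ->
  Omega (shear L P (relax_iter t X k)).
Proof.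
case: f_nc => fO _ _ OP fP t01 OX OS; elim: k => //= k IH.
have OZ := relax_iter_in k t01 OX.
rewrite -[X in shear _ X](tuple_mix_id t P) shear_mix.
apply: matrix_convex_mix => //; rewrite -{1}fP -nc_map_shear //.
exact: fO.
Qed.

(* Compressing [shear (c *: L) P Z] to the column [-a L; b] gives
   [Z + a (b c - a) (Z - L^* P L)], a point beyond Z as seen from [L^* P L]. *)
Lemma shear_extend N n (L : 'M[R[i]]_(N.+1, n.+1)) P (c : R) :
  isometry_mx L -> 0 < c ->
  exists2 s : R, 0 < s <= 1 & forall Z, Omega (shear (c%:C%C *: L) P Z) ->
    exists2 Y : mtuple R d n.+1, Omega Y & Z = tuple_mix s Y (tuple_compr L P).
Proof.
move=> LL c0; have [a [b [a0 ab abc]]] := unit_circle_slope c0.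
pose s := a * (b * c - a); have s0 : 0 < s by rewrite mulr_gt0 // subr_gt0.
have s1 : 0 < 1 + s by rewrite addr_gt0.
(* Solving Y = Z + s (Z - p) for Z, with p the compression of P, gives p the weight s / (1 + s). *)
exists (s / (1 + s)) => [|Z OS].
  by rewrite divr_gt0 //= ler_pdivrMr // mul1r lerDr.
pose V : 'M[R[i]]_(N.+1 + n.+1, n.+1) :=
  col_mx ((- a)%:C%C *: L) (b%:C%C%:M).
have Vadj : V^t* = row_mx ((- a)%:C%C *: L^t*) (b%:C%C%:M).
  rewrite /V tr_col_mx map_row_mx adj_real_scalar_mx linearZ /= map_mxZ /=.
  by congr (row_mx (_ *: _) _); exact: conjc_real.
have VV : isometry_mx V.
  rewrite /isometry_mx Vadj /V mul_row_col -scalemxAl -scalemxAr scalerA LL.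
  rewrite -scalar_mxM scalemx1 -!rmorphM -raddfD -rmorphD /=.
  by rewrite mulrNN -!expr2 ab.
exists (tuple_compr V (shear (c%:C%C *: L) P Z : mtuple R d (N.+1 + n.+1))).
  case: Omega_convex => _ compr.
  by apply: (compr (N + n.+1)%N n V).
apply: funext => i; rewrite /tuple_mix /tuple_compr /shear /tuple_tri Vadj /V.
rewrite mul_row_block mul_row_col mulmx0 addr0.
rewrite -!scalemxAl -!scalemxAr -scalerBr.
rewrite mulmxDl -!scalemxAl -!scalemxAr mul_scalar_mx.
rewrite !mul_mx_scalar -?scalemxAr mulmxBr !mulmxA.
have -> : L^t* *m L = 1%:M by exact: LL.
rewrite mul1mx; move: (L^t* *m P i *m L) => p; pose m := s / (1 + s).
have mE : 1 - m = (1 + s)^-1 by rewrite /m; field; rewrite gt_eqF.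
have zE : (1 - m) * (a * c * b + b * b) = 1.
  rewrite mE; have -> : a * c * b + b * b = 1 + s by rewrite /s -ab; ring.
  by rewrite mulVf // gt_eqF.
have pE : (1 - m) * (a * a - a * c * b) + m = 0.
  rewrite mE; have -> : a * a - a * c * b = - s by rewrite /s; ring.
  by rewrite mulrN mulrC addNr.
rewrite -/m; apply/matrixP => j l; rewrite !mxE.
transitivity (((1 - m) * (a * c * b + b * b))%:C%C * Z i j l +
    ((1 - m) * (a * a - a * c * b) + m)%:C%C * p j l).
  by rewrite zE pE rmorph0 rmorph1 mul1r mul0r addr0.
clearbody m; rewrite !(rmorphB, rmorphN, rmorphD, rmorphM, rmorph1) /=; ring.
Qed.

(** The weight s is chosen before Z, so a ball of radius r around the compression of P yields balls
    of the same radius s r around all [Z p]; one of them contains W. *)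
Lemma shear_limit_in N n (L : 'M[R[i]]_(N.+1, n.+1)) P (c : R) Z
    (W : mtuple R d n.+1) :
  isometry_mx L -> 0 < c -> Omega P ->
  (forall p, Omega (shear (c%:C%C *: L) P (Z p))) ->
  (forall e, 0 < e -> exists p : nat, close e (Z p) W) -> Omega W.
Proof.
move=> LL c0 OP OZ ZW; have [s /andP[s0 s1] sP] := shear_extend P LL c0.
have OL : Omega (tuple_compr L P) by case: Omega_convex => _; exact.
have [r r0 Or] := open_close (@Omega_open _) OL.
have [p Zp] := ZW (s * r) (mulr_gt0 s0 r0).
have [Y OY ZE] := sP _ (OZ p).
apply: (matrix_convex_ball Omega_convex _ Or OY (t := s)); first by rewrite s0.
by rewrite -ZE; exact: close_sym.
Qed.

Lemma isometry_pid N n : (n <= N)%N ->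
  isometry_mx (pid_mx n.+1 : 'M[R[i]]_(N.+1, n.+1)).
Proof.
by move=> nN; rewrite /isometry_mx tr_pid_mx map_pid_mx pid_mx_id // pid_mx_1.
Qed.

Lemma relax_seq_limit (U : set_system nat) {UU : UltraFilter U} N n
    (P : mtuple R d N.+1) (X W : mtuple R d n.+1) :
  U --> \oo -> (n <= N)%N -> Omega P -> f P = P -> Omega X ->
  ultra_cvg U (relax_seq X) W -> Omega W /\ f W = W.
Proof.
move=> Uoo nN OP fP OX XW.
(* The coordinate inclusion lets the fixed point P live at a higher level than X. *)
have [c c0 Oc] := shear_small (pid_mx n.+1 : 'M[R[i]]_(N.+1, n.+1)) OP OX.
have OW : Omega W.
  apply: (@shear_limit_in _ _ _ P c (relax_seq X) W (isometry_pid nN)) => //.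
    by move=> p; apply: relax_iter_shear => //; exact: relax_weight_ge0.
  by move=> e e0; have [p] := filter_ex (XW _ e0); exists p.
split=> //; apply: close_eq => e e0.
have e30 : 0 < e / 3 by rewrite divr_gt0.
have [r r0 rP] := nc_map_continuous OW e30.
have [C C0 CP] := relax_seq_approx OX.
(* U contains the tails of the integers, so the approximation error is small on a set of U. *)
have Ularge : U [set p | C / p.+1%:R < e / 3].
  apply: Uoo; exists (Num.truncn (C / (e / 3))) => // p /= Cp.
  rewrite ltr_pdivrMr // mulrC -ltr_pdivrMr //.
  by apply: lt_le_trans (truncnS_gt _) _; rewrite ler_nat ltnS.
have [p /= [[pW pr] pC]] :=
  filter_ex (filterI (filterI (XW _ e30) (XW _ r0)) Ularge).
have [_ fpW] := rP _ pr.
have fp : close (e / 3) (f (relax_seq X p)) (relax_seq X p).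
  by move=> i j k; exact: le_lt_trans (CP _ _ _ _) pC.
have -> : e = e / 3 + e / 3 + e / 3 by field.
exact: close_trans (close_trans (close_sym fpW) fp) pW.
Qed.

End NCMap.

(** * Ultralimits of direct sums and similarities *)

Section UltraLimitOperations.
Variables (R : realType) (d : nat) (U : set_system nat).
Context {UU : UltraFilter U}.

Lemma ultra_cvg_cst n m (W : 'I_d -> 'M[R[i]]_(n, m)) :
  ultra_cvg U (fun=> W) W.
Proof. by move=> e e0; apply: filterE => p; exact: close_refl. Qed.

Lemma ultra_cvg_dsum n m (X : nat -> mtuple R d n.+1)
    (Y : nat -> mtuple R d m.+1) (V : mtuple R d n.+1) (W : mtuple R d m.+1) :
  ultra_cvg U X V -> ultra_cvg U Y W ->
  ultra_cvg U (fun p => tuple_dsum (X p) (Y p)) (tuple_dsum V W).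
Proof.
move=> XV YW e e0; apply: filterS2 (XV e e0) (YW e e0) => p /= pV pW.
rewrite -!shear0; apply: close_tri => // i j k.
by rewrite !mulmx0 !mul0mx subrr normc0.
Qed.

Lemma close_mulmx n (A B : 'M[R[i]]_n) :
  exists2 C : R, 0 < C & forall e (X Y : 'I_d -> 'M[R[i]]_n), 0 < e ->
    close e X Y ->
    close (C * e) (fun i => A *m X i *m B) (fun i => A *m Y i *m B).
Proof.
pose a j k := \sum_l \sum_h normc (A j h) * normc (B l k).
have a0 j k : 0 <= a j k.
  by do 2 apply: sumr_ge0 => ? _; rewrite mulr_ge0 // normc_ge0.
exists (1 + \sum_j \sum_k a j k) => [|e X Y e0 XY i j k].
  by rewrite ltr_pwDl // !sumr_ge0 // => j _; rewrite sumr_ge0.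
have -> : (A *m X i *m B) j k - (A *m Y i *m B) j k =
    (A *m (X i - Y i) *m B) j k.
  by rewrite mulmxBr mulmxBl !mxE.
apply: (@le_lt_trans _ _ (a j k * e)); last first.
  rewrite ltr_pM2r // (bigD1 j) //= (bigD1 k) //= -addrA [ltRHS]addrCA ltrDl.
  have S0 (I : finType) (P : pred I) (F : I -> R) :
    (forall x, 0 <= F x) -> 0 <= \sum_(x | P x) F x.
    by move=> F0; exact: sumr_ge0.
  by rewrite ltr_pwDl // addr_ge0 // S0 // => x; exact: S0.
rewrite mxE; apply: le_trans (normc_sum _ _) _.
rewrite /a mulr_suml; apply: ler_sum => l _.
rewrite mxE normc_mul mulr_suml.
apply: le_trans (ler_wpM2r (normc_ge0 _) (normc_sum _ _)) _.
rewrite mulr_suml; apply: ler_sum => h _.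
rewrite normc_mul mulrAC ler_wpM2l ?mulr_ge0 ?normc_ge0 //.
by rewrite !mxE; exact/ltW/XY.
Qed.

Lemma ultra_cvg_sim n (S : 'M[R[i]]_n) (X : nat -> mtuple R d n) W :
  ultra_cvg U X W -> ultra_cvg U (fun p => tuple_sim S (X p)) (tuple_sim S W).
Proof.
move=> XW e e0; have [C C0 CP] := close_mulmx (invmx S) S.
have eC0 : 0 < e / C by rewrite divr_gt0.
apply: filterS (XW _ eC0) => p /= /(CP _ _ _ eC0).
by rewrite mulrCA divff ?gt_eqF // mulr1.
Qed.

End UltraLimitOperations.

(** * The retraction onto the fixed points *)

Section Retraction.
Variables (R : realType) (d : nat) (Omega : nc_family R d).
Hypothesis Omega_open : nc_open Omega.
Hypothesis Omega_bounded : nc_bounded Omega.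
Hypothesis Omega_convex : matrix_convex Omega.
Variable f : nc_function R d.
Hypothesis f_nc : nc_map Omega f.

Lemma relax_seq_dsum n m (X : mtuple R d n.+1) (Y : mtuple R d m.+1) p :
  Omega X -> Omega Y ->
  relax_seq f (tuple_dsum X Y) p =
    tuple_dsum (relax_seq f X p) (relax_seq f Y p).
Proof.
case: (f_nc) => _ fD _ OX OY; rewrite /relax_seq.
elim: (p.+1 * p.+1)%N => //= k IH.
rewrite IH /relax fD ?dsum_mix //;
  by apply: relax_iter_in => //; exact: relax_weight_ge0.
Qed.

Lemma relax_seq_sim n (S : 'M[R[i]]_n.+1) (X : mtuple R d n.+1) p :
  S \in unitmx -> Omega X -> Omega (tuple_sim S X) ->
  relax_seq f (tuple_sim S X) p = tuple_sim S (relax_seq f X p).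
Proof.
case: (f_nc) => _ _ fS Su OX OSX; rewrite /relax_seq.
elim: (p.+1 * p.+1)%N => //= k IH.
rewrite IH /relax fS ?sim_mix // -?IH;
  by apply: relax_iter_in => //; exact: relax_weight_ge0.
Qed.

Lemma nc_retraction_fixed_points :
  (forall n, exists N (P : mtuple R d N.+1),
    [/\ (n <= N)%N, Omega P & f P = P]) ->
  exists psi : nc_function R d, nc_retraction Omega psi /\
    forall n, [set psi n X | X in @Omega n] = fixed_points Omega f n.
Proof.
move=> Pfix; have [K K0 OK] := nc_bounded_entries Omega_bounded.
(* A single ultrafilter serves all levels and all points; this is why the limits commute with direct
   sums and similarities. *)
have [U [UU Uoo]] := ultraFilterLemma (_ : ProperFilter \oo).
pose psi : nc_function R d := fun n X =>
  xget X [set W : mtuple R d n.+1 | ultra_cvg U (relax_seq f X) W].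
have psi_cvg n (X : mtuple R d n.+1) : Omega X ->
    ultra_cvg U (relax_seq f X) (psi n X).
  move=> OX; have [|W WP] := @ultra_cvg_exists _ U UU _ _ _ (relax_seq f X) K.
    by move=> p i j k; apply: OK; exact: relax_seq_in.
  by rewrite /psi; case: xgetP => [_ -> //|/(_ W)].
have psi_fix n (X : mtuple R d n.+1) :
    Omega X -> Omega (psi n X) /\ f (psi n X) = psi n X.
  move=> OX; have [N [P [nN OP fP]]] := Pfix n.
  exact: (relax_seq_limit Omega_open Omega_convex K0 OK f_nc Uoo nN OP fP OX
    (psi_cvg _ _ OX)).
have fix_psi n (X : mtuple R d n.+1) : Omega X -> f X = X -> psi n X = X.
  move=> OX fX; apply: ultra_cvg_unique (psi_cvg _ _ OX) _.
  rewrite (_ : relax_seq f X = fun=> X); first exact: ultra_cvg_cst.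
  by apply: funext => p; exact: relax_seq_fixed.
exists psi; split; last first.
  move=> n; apply/seteqP; split => [_ [X OX <-]|X [OX fX]].
    exact: psi_fix.
  by exists X => //; exact: fix_psi.
split; last by move=> n X OX; have [] := psi_fix _ _ OX; exact: fix_psi.
case: Omega_convex => dsum _; split.
- by move=> n X OX; have [] := psi_fix _ _ OX.
- move=> n m X Y OX OY.
  apply: ultra_cvg_unique (psi_cvg _ _ (dsum _ _ _ _ OX OY)) _.
  rewrite (_ : relax_seq f (tuple_dsum X Y) =
    fun p => tuple_dsum (relax_seq f X p) (relax_seq f Y p)).
    by apply: ultra_cvg_dsum; exact: psi_cvg.
  by apply: funext => p; exact: relax_seq_dsum.
- move=> n S X Su OX OSX; apply: ultra_cvg_unique (psi_cvg _ _ OSX) _.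
  rewrite (_ : relax_seq f (tuple_sim S X) =
    fun p => tuple_sim S (relax_seq f X p)).
    by apply: ultra_cvg_sim; exact: psi_cvg.
  by apply: funext => p; exact: relax_seq_sim.
Qed.

End Retraction.

(** * The equivalence *)

Lemma nc_set_large_levels (R : realType) d (V : nc_family R d) n : nc_set V ->
  (exists n, V n !=set0) -> exists N, (n <= N)%N /\ V N !=set0.
Proof.
move=> Vdsum V0; elim: n => [|n [N [nN [X VX]]]].
  by have [N VN] := V0; exists N.
(* Doubling a point of size N + 1 gives size 2 N + 2, which is level N + N.+1. *)
exists (N + N.+1)%N; split; last by exists (tuple_dsum X X); exact: Vdsum.
by rewrite addnS ltnS (leq_trans nN) // leq_addr.
Qed.

Theorem theorem5p1 (R : realType) (d : nat) (Omega V : nc_family R d)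
    (Omega_open : nc_open Omega) (Omega_bounded : nc_bounded Omega)
    (Omega_convex : matrix_convex Omega)
    (V_sub : forall n : nat, V n `<=` Omega n)
    (V_nc : nc_set V) (V_bifull : relatively_bifull Omega V)
    (V_smooth : forall n : nat, smooth_analytic_subvariety (Omega n) (V n))
    (V_nonempty : exists n : nat, V n !=set0) :
  (exists f : nc_function R d,
      nc_map Omega f /\ forall n : nat, V n = fixed_points Omega f n) <->
  (exists psi : nc_function R d,
      nc_retraction Omega psi /\ forall n : nat, [set psi n X | X in Omega n] = V n).
Proof.
split=> [[f [f_nc Vf]]|[psi [[psi_nc psi_idem] psiV]]].
  have [|psi [psi_retr psiE]] :=
      nc_retraction_fixed_points Omega_open Omega_bounded Omega_convex f_nc.
    move=> n; have [N [nN [P]]] := nc_set_large_levels n V_nc V_nonempty.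
    by rewrite Vf => -[OP fP]; exists N, P.
  by exists psi; split=> // n; rewrite psiE Vf.
(* Conversely f = psi works: the image of an idempotent map is its fixed point set. *)
exists psi; split=> // n; rewrite -psiV; apply/seteqP.
split=> [_ [X OX <-]|X [OX psiX]]; last by exists X.
by split; [case: psi_nc => psiO _ _; exact: psiO|exact: psi_idem].
Qed.
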